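(* Let $G$ be a planar graph. Then $\chi_\ell(G^2)\le \Delta(G)^2+1$ if $\Delta(G)\le5$, and $\chi_\ell(G^2)\le 7\Delta(G)-7$ if $\Delta(G)\ge6$.
   Context: Graphs are finite and simple; $\Delta(G)$ is the maximum degree. $G^2$ is the graph on $V(G)$ in which two vertices are adjacent when their distance in $G$ is $1$ or $2$. $\chi_\ell(H)$ is the least $k$ such that for every assignment of lists of size $k$ to the vertices of $H$ there is a proper coloring of $H$ choosing each vertex's color from its list. *)

(* Defs.v *)
From HB Require Import structures.
From mathcomp Require Import all_boot all_order all_algebra.
From mathcomp Require Import boolp classical_sets reals.

Set Implicit Arguments.
Unset Strict Implicit.
Unset Printing Implicit Defensive.

Import Order.TTheory GRing.Theory Num.Theory.

Record sgraph := SGraph {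
  vertex :> finType;
  edge : rel vertex;
  edge_sym : symmetric edge;
  edge_irrefl : irreflexive edge }.

Section Graphs.
Variable G : sgraph.

Definition degree (x : G) : nat := #|[pred y | edge x y]|.

Definition max_degree : nat := \max_(x : G) degree x.

Definition edges : {set {set G}} :=
  [set E : {set G} | [exists x, exists y, edge x y && (E == [set x; y])]]%SET.

Definition walk (n : nat) (x y : G) : bool :=
  [exists p : n.-tuple G, path (@edge G) x p && (last x p == y)].

Definition at_distance (n : nat) (x y : G) : bool :=
  walk n x y && [forall m : 'I_n, ~~ walk m x y].

Definition square_edge : rel G :=
  [rel x y | at_distance 1 x y || at_distance 2 x y].

Lemma walk_sym n : symmetric (walk n).
Proof.
suff walkI x y : walk n x y -> walk n y x by move=> x y; apply/idP/idP; apply: walkI.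
case/existsP=> p /andP[ep /eqP <-]; apply/existsP.
have sz : size (rev (belast x p)) == n by rewrite size_rev size_belast size_tuple.
exists (Tuple sz); rewrite /= rev_path.
have /eq_path -> : (fun u v : G => edge v u) =2 @edge G.
  by move=> u v; rewrite edge_sym.
rewrite ep; case: (tval p) => [|a s] //=.
by rewrite rev_cons last_rcons eqxx.
Qed.

Lemma square_edge_sym : symmetric square_edge.
Proof.
have dist_sym n x y : at_distance n x y = at_distance n y x.
  rewrite /at_distance walk_sym; congr (_ && _).
  by apply: eq_forallb => m; rewrite walk_sym.
by move=> x y; rewrite /square_edge /= (dist_sym 1) (dist_sym 2).
Qed.

Lemma square_edge_irrefl : irreflexive square_edge.
Proof.
have w0 (x : G) : walk 0 x x by apply/existsP; exists [tuple]; rewrite /= eqxx.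
move=> x /=; apply/negP => /orP[] /andP[_ /forallP /(_ ord0)];
  by rewrite w0.
Qed.

Definition square : sgraph := SGraph square_edge_sym square_edge_irrefl.

Definition choosable (k : nat) : Prop :=
  forall (C : finType) (L : G -> {set C}), (forall x, #|L x| = k) ->
  exists c : G -> C,
    (forall x, c x \in L x) /\ (forall x y, edge x y -> c x != c y).

Lemma choosable_card : choosable #|G|.
Proof.
move=> C L szL.
have Lex x : exists a, a \in L x.
  by apply/card_gt0P; rewrite szL; apply/card_gt0P; exists x.
suff /(_ (enum G)) [] : forall s : seq G, uniq s -> exists c : G -> C,
    (forall x, c x \in L x) /\ {in s &, injective c}.
- exact: enum_uniq.
- move=> c [cL cI]; exists c; split=> // x y exy; apply: contraTneq exy.
  by move/cI => -> //; rewrite ?mem_enum // edge_irrefl.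
elim=> [|v s IH] /=.
  by move=> _; exists (fun x => xchoose (Lex x)); split=> // x; apply: xchooseP.
case/andP=> vs us; have [c [cL cI]] := IH us.
have /card_gt0P[a] : 0 < #|L v :\: [set c x | x in s]%SET|.
  rewrite cardsD szL subn_gt0.
  apply: leq_ltn_trans (subset_leq_card (subsetIr _ _)) _.
  apply: leq_ltn_trans (leq_imset_card _ _) _.
  apply: leq_ltn_trans (card_size s) _.
  have /card_uniqP szs : uniq (v :: s) by rewrite /= vs.
  by have := max_card (mem (v :: s)); rewrite szs.
rewrite inE => /andP[aN aL].
have ac x : x \in s -> a <> c x.
  by move=> xs ax; case/negP: aN; rewrite ax; apply: imset_f.
exists (fun x => if x == v then a else c x); split=> [x|x y].
  by case: eqP => [->|].
rewrite !inE; case: eqP => [->|_] /=; case: eqP => [->|_] //=.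
- by move=> _ ys /(ac _ ys).
- by move=> xs _ /esym /(ac _ xs).
exact: cI.
Qed.

Lemma exists_choosable : exists k, `[< choosable k >].
Proof. by exists #|G|; apply/asboolP; apply: choosable_card. Qed.

Definition list_chromatic_number : nat := ex_minn exists_choosable.

End Graphs.

Section Planarity.
Variable R : realType.
Local Open Scope ring_scope.
Local Open Scope classical_set_scope.

Notation point := 'rV[R]_2.

Definition segment (p q : point) : set point :=
  [set z | exists2 t : R, 0 <= t <= 1 & z = (1 - t) *: p + t *: q].

(* The union of the segments joining consecutive points of p :: s. *)
Fixpoint polyline (p : point) (s : seq point) : set point :=
  if s is q :: s' then segment p q `|` polyline q s' else [set p].

Fixpoint simple_polyline (p : point) (s : seq point) : Prop :=
  if s is q :: s' then
    [/\ p <> q, segment p q `&` polyline q s' = [set q]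
      & simple_polyline q s']
  else True.

Definition polygonal_arc (p q : point) (A : set point) : Prop :=
  exists s : seq point,
    [/\ simple_polyline p s, last p s = q & A = polyline p s].

(* Edges are drawn as polygonal arcs, as in the textbooks of West and Diestel;
   allowing arbitrary simple curves yields the same class of graphs.  Only the
   values of [arc] on [edges G] matter. *)
Record plane_drawing (G : sgraph) (pos : G -> point)
    (arc : {set G} -> set point) : Prop := PlaneDrawing {
  drawing_inj : injective pos;
  drawing_arc : forall x y : G, edge x y ->
    polygonal_arc (pos x) (pos y) (arc [set x; y]%SET);
  drawing_vertex : forall (E : {set G}) (x : G),
    E \in edges G -> arc E (pos x) -> x \in E;
  drawing_cross : forall E F : {set G},
    E \in edges G -> F \in edges G -> E <> F ->
    forall p : point, arc E p -> arc F p ->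
    exists2 x : G, x \in (E :&: F)%SET & p = pos x }.

Definition planar (G : sgraph) : Prop :=
  exists (pos : G -> point) (arc : {set G} -> set point),
    plane_drawing pos arc.

End Planarity.

(* Main.v *)
(* A drawing is reduced to linear algebra over F_2.  For an edge ij and a vertex
   k off it, let h(ij;k) be the parity of the number of times a ray issued from k
   meets the arc ij.  If the arcs ij and kl are disjoint, then
     h(ij;k) + h(ij;l) + h(kl;i) + h(kl;j)
   is 1 or 0 according to whether the heights of i, j and of k, l interleave.
   The graphs for which such a system has a solution are closed under contraction
   and under replacing a vertex of degree 3 by a triangle, and they exclude K_5:
   summed over the 15 pairs of independent edges, the left-hand sides cancel while
   the right-hand sides add up to 1.  Mader's contraction argument then bounds
   their number of edges by 3n - 2.

   Let D be the maximum degree and S a set of vertices.  Replace each vertex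
   outside S with at most 3 neighbours in S by a clique on these neighbours, and
   keep the outer vertices with at least 4.  The edge bound shows that for D >= 6
   the square has average degree less than 6D on S, which settles D >= 7.  For
   D = 6, remove vertices of degree at most 5 one by one, contracting each into a
   neighbour: a vertex has at most 8D - 15 = 33 square-neighbours left when it is
   removed.  For D <= 5 the square has maximum degree at most D^2. *)
Require Import Defs.
From Stdlib Require Import Btauto.
From mathcomp Require Import all_boot all_order all_algebra.
From mathcomp Require Import reals.
From mathcomp Require Import zify ring lra.

Set Implicit Arguments.
Unset Strict Implicit.
Unset Printing Implicit Defensive.

(** * Boolean and counting preliminaries *)

Lemma addb_xorb a b : a (+) b = xorb a b.
Proof. by case: a; case: b. Qed.

Ltac xor := rewrite ?addb_xorb; btauto.

Lemma card_bigcup_leq (I T : finType) (A : {set I}) (F : I -> {set T}) :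
  #|\bigcup_(i in A) F i| <= \sum_(i in A) #|F i|.
Proof.
apply: (big_ind2 (fun (B : {set T}) n => #|B| <= n)); first by rewrite cards0.
  move=> B m C n lm ln; rewrite cardsU; lia.
by [].
Qed.

(** * The mod 2 van Kampen system of a graph *)

Section VanKampen.
Variable V : finType.
Implicit Types (r : rel V) (S W : {set V}).

(* Vanishing of the mod 2 van Kampen obstruction.  [o] stands for the comparison
   of heights, but being a tournament is all that is needed of it; [h i j] and
   [h j i] are not required to agree. *)
Definition van_kampen r : Prop :=
  exists (h : V -> V -> V -> bool) (o : V -> V -> bool),
    (forall x y, x != y -> o y x = ~~ o x y) /\
    (forall i j k l, r i j -> r k l -> uniq [:: i; j; k; l] ->
       h i j k (+) h i j l (+) h k l i (+) h k l j =
       o k i (+) o l i (+) o k j (+) o l j).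

Lemma van_kampen_sub r r' : subrel r' r -> van_kampen r -> van_kampen r'.
Proof.
move=> sr [h [o [oN ho]]]; exists h, o; split=> // i j k l /sr rij /sr rkl.
exact: ho.
Qed.

(* The new edges of [r'] are drawn along paths of length 2 through the deleted
   vertices [W]; two independent new edges may not use the same one. *)
Lemma van_kampen_reroute r r' W :
    (forall x y, r' x y -> (x \notin W) && (y \notin W)) ->
    (forall x y, r' x y -> ~~ r x y -> exists2 u, u \in W & r u x && r u y) ->
    (forall u x y k l, u \in W -> r' x y -> r' k l -> ~~ r x y -> ~~ r k l ->
       r u x -> r u y -> r u k -> r u l -> uniq [:: x; y; k; l] -> False) ->
  van_kampen r -> van_kampen r'.
Proof.
move=> r'W via ind [h [o [oN ho]]].
pose h' i j k := if r i j then h i j k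
  else if [pick u in W | r u i && r u j] is Some u then h u i k (+) h u j k
  else false.
have h'P i j : r' i j -> (r i j /\ h' i j =1 h i j) \/
    exists u, [/\ u \in W, r u i, r u j, ~~ r i j &
                  forall k, h' i j k = h u i k (+) h u j k].
  move=> rij; rewrite /h'; have [_|nr] := boolP (r i j); first by left.
  right; case: pickP => [u /and3P[uW ui uj]|no]; first by exists u.
  by have [u uW uij] := via _ _ rij nr; have := no u; rewrite uW uij.
exists h', o; split=> // i j k l rij rkl Uijkl.
have /andP[iW jW] := r'W _ _ rij; have /andP[kW lW] := r'W _ _ rkl.
have nW u x : u \in W -> x \notin W -> (u == x = false) * (x == u = false).
  move=> uW xW; have ux : u == x = false by apply: contraNF xW => /eqP<-.
  by split; rewrite // eq_sym.
move: (Uijkl); rewrite /= !inE !negb_or -!andbA.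
case/and5P=> ij ik il jk /and3P[jl kl _].
case: (h'P _ _ rij) => [[rij0 hij]|[u [uW ui uj nij hij]]];
case: (h'P _ _ rkl) => [[rkl0 hkl]|[v [vW vk vl nkl hkl]]]; rewrite !{}hij !{}hkl.
- exact: ho.
(* The equations for [i j] against the two halves [v k] and [v l] of the path are added: [h i j v],
   [o v i] and [o v j] occur twice and cancel. *)
- have := ho i j v k rij0 vk; have := ho i j v l rij0 vl.
  rewrite /= !inE !(nW v) // !negb_or ?ij ?ik ?il ?jk ?jl ?kl /=.
  move=> /(_ isT) H2 /(_ isT) H1; have := congr2 addb H1 H2.
  set a := (X in X = _ -> _); set b := (X in _ = X -> _) => H.
  by transitivity a; [|rewrite H]; rewrite /a /b; xor.
- have := ho u i k l ui rkl0; have := ho u j k l uj rkl0.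
  rewrite /= !inE !(nW u) // !negb_or ?ij ?ik ?il ?jk ?jl ?kl /=.
  move=> /(_ isT) H2 /(_ isT) H1; have := congr2 addb H1 H2.
  set a := (X in X = _ -> _); set b := (X in _ = X -> _) => H.
  by transitivity a; [|rewrite H]; rewrite /a /b; xor.
(* Both edges are new. Their middle vertices differ by the independence hypothesis, so the four
   equations between a half of one path and a half of the other are available; in their sum every
   term involving [u] or [v] as a tested vertex cancels. *)
have uv : u != v.
  apply/eqP => uv; subst v; exact: (ind u i j k l).
have vu : v != u by rewrite eq_sym.
have := ho u i v k ui vk; have := ho u i v l ui vl.
have := ho u j v k uj vk; have := ho u j v l uj vl.
rewrite /= !inE !negb_or ?uv ?vu ?ij ?ik ?il ?jk ?jl ?kl ?(nW u) // ?(nW v) //=.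
move=> /(_ isT) H4 /(_ isT) H3 /(_ isT) H2 /(_ isT) H1.
have := congr2 addb (congr2 addb H1 H2) (congr2 addb H3 H4).
set a := (X in X = _ -> _); set b := (X in _ = X -> _) => H.
by transitivity a; [|rewrite H]; rewrite /a /b; xor.
Qed.

Lemma van_kampen_K5 r a b c d e : van_kampen r ->
  uniq [:: a; b; c; d; e] -> pairwise r [:: a; b; c; d; e] -> False.
Proof.
case=> [h [o [oN ho]]].
(* [q] adds the left-hand sides over the three pairs of opposite edges of a K_4. On the right, what
   survives is [o] in both orders on each of the three pairs within j, k, l, hence 1. Each term
   [h i j k] lies in exactly two of the five K_4's of K_5, always with its endpoints in the same
   order, so the five [q] add up to 0 instead of 5 = 1. *)
pose q i j k l := (h i j k (+) h i j l (+) h k l i (+) h k l j) (+)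
  (h i k j (+) h i k l (+) h j l i (+) h j l k) (+)
  (h i l j (+) h i l k (+) h j k i (+) h j k l).
have qT i j k l : uniq [:: i; j; k; l] -> pairwise r [:: i; j; k; l] ->
    q i j k l = true.
  rewrite /= !inE !negb_or !andbT -!andbA.
  case/and5P=> ij ik il jk /andP[jl kl].
  case/and5P=> rij rik ril rjk /andP[rjl rkl]; rewrite /q !ho //=;
    rewrite ?inE ?negb_or 1?[k == j]eq_sym 1?[l == j]eq_sym 1?[l == k]eq_sym
      ?ij ?ik ?il ?jk ?jl ?kl //.
  rewrite (oN _ _ jk) (oN _ _ kl) (oN _ _ jl); xor.
rewrite /= !inE !negb_or !andbT -!andbA.
case/and5P=> ab ac ad ae; case/and5P=> bc bd be cd /andP[ce de].
case/and5P=> rab rac rad rae; case/and5P=> rbc rbd rbe rcd /andP[rce rde].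
suff : q a b c d (+) q a b c e (+) q a b d e (+) q a c d e (+) q b c d e = false.
  rewrite !qT //= ?inE ?negb_or ?ab ?ac ?ad ?ae ?bc ?bd ?be ?cd ?ce ?de //;
    by rewrite ?rab ?rac ?rad ?rae ?rbc ?rbd ?rbe ?rcd ?rce ?rde.
rewrite /q; xor.
Qed.
End VanKampen.

(** * Contraction and the edge bound *)

Section Sparse.
Variable V : finType.
Implicit Types (r : rel V) (S W : {set V}).

Definition nbr r x : {set V} := [set y | r x y].
Definition arcs r : {set V * V} := [set p | r p.1 p.2].

Lemma card_arcs r : #|arcs r| = \sum_x #|nbr r x|.
Proof.
rewrite -sum1_card (eq_bigr (fun x => \sum_(y in nbr r x) 1)); last first.
  by move=> x _; rewrite sum1_card.
rewrite pair_big_dep; apply: eq_bigl => -[x y]; by rewrite !inE.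
Qed.

Definition contract r u w : rel V :=
  [rel x y | [&& x != u, y != u, x != y &
              [|| r x y, (x == w) && r u y | (y == w) && r u x]]].

Lemma contract_sym r u w : symmetric r -> symmetric (contract r u w).
Proof.
move=> rs x y; rewrite /contract /= rs [x == y]eq_sym.
by case: (x == u); case: (y == u); rewrite ?andbF //= [_ && r u y || _]orbC.
Qed.

Lemma contract_irr r u w : irreflexive (contract r u w).
Proof. by move=> x; rewrite /contract /= eqxx !andbF. Qed.

(** A new edge at [w] is routed along the path through [u]. All new edges share the end [w], so no
    two of them are independent. *)
Lemma contract_van_kampen r u w : symmetric r -> r u w ->
  van_kampen r -> van_kampen (contract r u w).
Proof.
move=> rs uw; apply: (van_kampen_reroute (W := [set u])).
- by move=> x y; rewrite !inE => /and3P[-> ->].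
- move=> x y /and4P[_ _ _ h] nr; exists u; rewrite ?inE //.
  by move: h; rewrite (negPf nr) /= => /orP[] /andP[/eqP-> ->]; rewrite uw.
- move=> v x y k l; rewrite inE => /eqP->.
  move=> /and4P[_ _ _ h1] /and4P[_ _ _ h2] n1 n2 _ _ _ _.
  move: h1 h2; rewrite (negPf n1) (negPf n2) /=.
  by move=> /orP[] /andP[/eqP-> _] /orP[] /andP[/eqP-> _];
     rewrite /= !inE eqxx ?orbT ?andbF.
Qed.

(** Deleting [u] costs two arcs per neighbour. The neighbours in [P], other than [w] and not
    adjacent to [w], give back two arcs each at [w]; the loss is thus two arcs for each common
    neighbour and two for the edge [u w]. *)
Lemma contract_arcs r u w : symmetric r -> irreflexive r -> r u w ->
  #|arcs r| <= #|arcs (contract r u w)| + (#|nbr r u :&: nbr r w|.+1).*2.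
Proof.
move=> rs ri uw.
pose P := (nbr r u :\: nbr r w) :\ w.
have uNw : u != w by apply: contraTneq uw => ->; rewrite ri.
have cP : #|nbr r u| = #|nbr r u :&: nbr r w| + #|P|.+1.
  rewrite -(cardsID (nbr r w) (nbr r u)) [in LHS](cardsD1 w (_ :\: _)).
  by rewrite !inE ri uw /P; lia.
pose E0 := [set p : V * V | [&& r p.1 p.2, p.1 != u & p.2 != u]].
have l1 : #|arcs r| <= #|E0| + (#|nbr r u|).*2.
  have : arcs r \subset E0 :|: setX [set u] (nbr r u) :|: setX (nbr r u) [set u].
    apply/subsetP => -[x y]; rewrite !inE /= => xy; rewrite xy /=.
    case: (eqVneq x u) xy => [->|_] xy; first by rewrite xy orbT.
    by case: (eqVneq y u) xy => [->|_] xy //=; rewrite rs xy.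
  move/subset_leq_card/leq_trans; apply.
  apply: leq_trans (leq_card_setU _ _) _; rewrite cardsX cards1 muln1.
  rewrite -addnn addnA leq_add2r.
  by apply: leq_trans (leq_card_setU _ _) _; rewrite cardsX cards1 mul1n.
have l2 : #|E0| + (#|P|).*2 <= #|arcs (contract r u w)|.
  have <- : #|E0 :|: setX [set w] P :|: setX P [set w]| = #|E0| + (#|P|).*2.
    rewrite cardsU cardsU !cardsX !cards1 mul1n muln1.
    have -> : E0 :&: setX [set w] P = set0.
      apply/setP => -[x y]; rewrite !inE /=; apply/negP => /and3P[/andP[xy _]].
      by move/eqP=> xw; rewrite -xw xy !andbF.
    have -> : (E0 :|: setX [set w] P) :&: setX P [set w] = set0.
      apply/setP => -[x y]; rewrite !inE /=; apply/negP.
      case/andP=> /orP[/andP[xy _]|/andP[/eqP-> _]]; last by rewrite eqxx.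
      by case/andP=> /and3P[xw wx _] /eqP yw; move: wx; rewrite rs -yw xy.
    by rewrite cards0 !subn0 -addnn addnA.
  apply/subset_leq_card/subsetP => -[x y]; rewrite !inE /contract /=.
  have uN z : r u z -> z != u by apply: contraTneq => ->; rewrite ri.
  case/orP=> [/orP[/and3P[xy xu yu]|/and4P[/eqP-> yw _ uy]]|].
  - by rewrite xu yu xy; case: eqVneq xy => [->|]; rewrite ?ri.
  - by rewrite [w == u]eq_sym uNw uN // eq_sym yw eqxx uy orbT.
  - case/andP=> /and3P[xw _ ux] /eqP->.
    by rewrite [w == u]eq_sym uNw uN // xw eqxx ux !orbT.
lia.
Qed.

(* Otherwise [N(v)] has at most 5 vertices and minimum degree at least 3, hence a
   K_4 minor, which [v] extends to a K_5 minor. *)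
Lemma van_kampen_nbr r v : symmetric r -> irreflexive r -> van_kampen r ->
  0 < #|nbr r v| <= 5 ->
  exists2 w, r v w & #|nbr r v :&: nbr r w| <= 2.
Proof.
move=> rs ri vk /andP[N0 N5].
have [/exists_inP//|/exists_inPn no] :=
  boolP [exists w in r v, #|nbr r v :&: nbr r w| <= 2].
exfalso; have vN x : r v x -> v != x by apply: contraTneq => <-; rewrite ri.
have big w (X : {set V}) : r v w -> X \subset nbr r v :\: nbr r w ->
    #|X| + 2 < #|nbr r v|.
  move=> vw /subset_leq_card; have := no w vw; rewrite -ltnNge.
  by have := cardsID (nbr r w) (nbr r v); lia.
(* At most 2 vertices of N(v) lie outside the neighbourhood of [w], and [w] itself is one of
   them. *)
have miss w x y : r v w -> r v x -> r v y -> uniq [:: w; x; y] -> r w x || r w y.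
  move=> vw vx vy; rewrite /= !inE negb_or andbT => /andP[/andP[wx wy] xy].
  apply: contraT; rewrite negb_or => /andP[nx ny].
  have := @big w [set w; x; y] vw; rewrite -setUA cardsU1 cards2 !inE.
  rewrite negb_or wx wy xy => /(_ _) h; suff: 1 + 2 + 2 < #|nbr r v| by lia.
  apply: h; apply/subsetP => z; rewrite !inE.
  by case/or3P=> /eqP->; rewrite ?ri ?(negPf nx) ?(negPf ny).
pose L := enum (nbr r v).
have LN x : x \in L -> r v x by rewrite mem_enum inE.
have UL : uniq L by exact: enum_uniq.
have sL : size L = #|nbr r v| by rewrite -cardE.
have n4 : 4 <= #|nbr r v|.
  have /card_gt0P[w] := N0; rewrite inE => vw; have := @big w [set w] vw.
  by rewrite cards1 sub1set !inE ri vw => /(_ isT); lia.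
have clique a b c d : uniq [:: a; b; c; d] -> all (r v) [:: a; b; c; d] ->
    [&& r a b, r a c, r a d, r b c, r b d & r c d] -> False.
  move=> U /and5P[va vb vc vd _] /and5P[ab ac ad bc /andP[bd cd]].
  apply: (@van_kampen_K5 _ r v a b c d) => //.
    by rewrite cons_uniq U !inE !negb_or !vN.
  by rewrite /= va vb vc vd ab ac ad bc bd cd.
case: (ltngtP #|nbr r v| 4) => [|n5|{}n4]; first by lia.
  have {N5} : size L = 5 by lia.
  case: L UL LN {sL} => [|a [|b [|c [|d [|e []]]]]] //= U LN _.
  have [va vb vc vd ve] : [/\ r v a, r v b, r v c, r v d & r v e].
    by split; apply: LN; rewrite !inE eqxx ?orbT.
  (* The non-adjacent [i] and [j] both see all of [x], [y], [z]. Contracting [x] into [i] supplies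
     the edge [i j], so [v], [i], [j], [y], [z] form a K_5. *)
  have K1 i j x y z : uniq [:: i; j; x; y; z] -> all (r v) [:: i; j; x; y; z] ->
      ~~ r i j -> r y z -> False.
    rewrite /= !inE !negb_or !andbT -!andbA.
    case/and5P=> ij ix iy iz /and5P[jx jy jz xy /andP[xz yz]].
    case/and5P=> vi vj vx vy vz nij yz'.
    have ji : j != i by rewrite eq_sym.
    have nji : ~~ r j i by rewrite rs.
    have A w : r v w -> i != w -> j != w -> r i w && r j w.
      move=> vw iw jw; have := @miss i j w vi vj vw; have := @miss j i w vj vi vw.
      by rewrite /= !inE !negb_or ij ji iw jw (negPf nij) (negPf nji) /= => -> // ->.
    have /andP[ix' jx'] := A x vx ix jx; have /andP[iy' jy'] := A y vy iy jy.
    have /andP[iz' jz'] := A z vz iz jz.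
    have xi' : r x i by rewrite rs.
    have xj' : r x j by rewrite rs.
    apply: (@van_kampen_K5 _ (contract r x i) v i j y z).
    - exact: contract_van_kampen.
    - by rewrite /= !inE !negb_or !vN // ij iy iz jy jz yz.
    - rewrite /contract /= !vN //=.
      rewrite vi vj vy vz ij iy iz jy jz yz ix jx eqxx iy' iz' jy' jz' yz'.
      by rewrite [y == x]eq_sym [z == x]eq_sym xy xz xj' !orbT.
  (* If [y z] is missing then [z] sees [x], and [x] takes the role of [y]. Hence N(v) is
     complete. *)
  have K i j x y z : uniq [:: i; j; x; y; z] -> all (r v) [:: i; j; x; y; z] ->
      ~~ r i j -> False.
    move=> U' vA nij; have [yz|nyz] := boolP (r y z); first exact: (K1 i j x y z).
    move: (U') (vA); rewrite /= !inE !negb_or !andbT -!andbA.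
    case/and5P=> ij ix iy iz /and5P[jx jy jz xy /andP[xz yz]].
    case/and5P=> vi vj vx vy vz.
    apply: (K1 i j y x z) => //=.
    - by rewrite !inE !negb_or ij ix iy iz jx jy jz eq_sym xy yz xz.
    - by rewrite vi vj vx vy vz.
    - have := @miss z x y vz vx vy; rewrite /= !inE negb_or ![z == _]eq_sym xz yz xy.
      by rewrite ![r z _]rs (negPf nyz) orbF; apply.
  move: (U); rewrite /= !inE !negb_or !andbT -!andbA.
  case/and5P=> ab ac ad ae /and5P[bc bd be cd /andP[ce de]].
  have ba : b != a by rewrite eq_sym.
  have ca : c != a by rewrite eq_sym.
  have cb : c != b by rewrite eq_sym.
  have da : d != a by rewrite eq_sym.
  have db : d != b by rewrite eq_sym.
  have dc : d != c by rewrite eq_sym.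
  apply: (clique a b c d).
  - by rewrite /= !inE !negb_or ab ac ad bc bd cd.
  - by rewrite /= va vb vc vd.
  have Kr i j x y : uniq [:: i; j; x; y; e] -> all (r v) [:: i; j; x; y; e] -> r i j.
    by move=> U' vA; apply: contraT => /(K i j x y e U' vA).
  have vA : all (r v) [:: a; b; c; d; e] by rewrite /= va vb vc vd ve.
  rewrite (Kr a b c d) ?(Kr a c b d) ?(Kr a d b c) ?(Kr b c a d) ?(Kr b d a c) ?(Kr c d a b) //=;
    rewrite ?inE ?negb_or ?va ?vb ?vc ?vd ?ve //;
    by rewrite ?ab ?ac ?ad ?ae ?bc ?bd ?be ?cd ?ce ?de ?ba ?ca ?cb ?da ?db ?dc.
have {N5} : size L = 4 by lia.
case: L UL LN {sL} => [|a [|b [|c [|d []]]]] //= U LN _.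
have [va vb vc vd] : [/\ r v a, r v b, r v c & r v d].
  by split; apply: LN; rewrite !inE eqxx ?orbT.
have adj x y : r v x -> r v y -> x != y -> r x y.
  move=> vx vy xy; apply: contraT => nxy; have := @big x [set x; y] vx.
  rewrite cards2 xy n4 => /(_ _) h; suff: 2 + 2 < 4 by [].
  by apply: h; apply/subsetP => z; rewrite !inE => /orP[] /eqP->; rewrite ?ri ?(negPf nxy).
move: (U); rewrite /= !inE !negb_or !andbT -!andbA.
case/and5P=> ab ac ad bc /andP[bd cd].
apply: (clique a b c d) => //; first by rewrite /= va vb vc vd.
by rewrite (adj a b) // (adj a c) // (adj a d) // (adj b c) // (adj b d) // (adj c d).
Qed.

(** [arcs] counts each edge twice. Induction on the order, then on the size: some vertex has degree
    at most 5, and contracting it into a neighbour with at most 2 common neighbours loses at most 6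
    arcs. *)
Lemma van_kampen_sparse r S : symmetric r -> irreflexive r ->
  (forall x y, r x y -> x \in S) -> S != set0 -> van_kampen r ->
  #|arcs r|.+2 < 6 * #|S|.
Proof.
have [n] := ubnP #|S|; elim: n r S => // n IHn r S lt_n.
have [m] := ubnP #|arcs r|; elim: m r => // m IHm r lt_m rs ri rS S0 vk.
have cS : 0 < #|S| by rewrite card_gt0.
(* With 6|S| arcs or more, deleting one edge leaves a graph that already violates the bound: the
   slack of 2 is exactly the two arcs deleted. *)
have [big|small] := leqP (6 * #|S|) #|arcs r|.
  have /card_gt0P[[x y]] : 0 < #|arcs r| by lia.
  rewrite inE /= => xy.
  pose r' := [rel a b | r a b && ~~ ((a == x) && (b == y) || (a == y) && (b == x))].
  have sr : subrel r' r by move=> a b /andP[].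
  have E : arcs r' = arcs r :\ (x, y) :\ (y, x).
    apply/setP => -[a b]; rewrite !inE /= !xpair_eqE negb_or.
    by case: (r a b); rewrite ?andbF ?andbT //= andbC.
  have c : #|arcs r| = #|arcs r'|.+2.
    rewrite (cardsD1 (x, y)) (cardsD1 (y, x)) -E !inE /= xpair_eqE xy rs xy andbT.
    by case: eqP xy => [->|]; rewrite ?ri.
  have := IHm r'; rewrite c in lt_m big *.
  have -> : #|arcs r'| < m by lia.
  move=> /(_ isT); suff: [/\ symmetric r', irreflexive r' & forall a b, r' a b -> a \in S].
    by case=> h1 h2 h3 /(_ h1 h2 h3 S0 (van_kampen_sub sr vk)); lia.
  split=> [a b|a|a b /sr]; last exact: rS.
    by rewrite /r' /= rs orbC [(b == y) && _]andbC [(b == x) && _]andbC.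
  by rewrite /r' /= ri.
have arcsS : #|arcs r| = \sum_(x in S) #|nbr r x|.
  rewrite card_arcs [RHS]big_mkcond; apply: eq_bigr => x _.
  case: ifPn => // xS; apply/eqP; rewrite cards_eq0; apply/eqP/setP => y.
  by rewrite !inE; apply: contraNF xS => /rS.
have [v vS dv] : exists2 v, v \in S & #|nbr r v| <= 5.
  have [/exists_inP//|/exists_inPn no] := boolP [exists v in S, #|nbr r v| <= 5].
  suff: 6 * #|S| <= #|arcs r| by lia.
  rewrite arcsS mulnC -sum_nat_const; apply: leq_sum => x xS.
  by rewrite ltnNge; apply: no.
have cv : #|S| = #|S :\ v|.+1 by rewrite (cardsD1 v) vS.
have [/eqP|] := posnP #|nbr r v|.
  rewrite cards_eq0 => /eqP n0; have vN x : r v x = false.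
    by have /setP/(_ x) := n0; rewrite !inE.
  have [/eqP|c0] := posnP #|S :\ v|.
    rewrite cards_eq0 => /eqP S1; suff -> : #|arcs r| = 0 by lia.
    apply/eqP; rewrite cards_eq0; apply/eqP/setP => -[x y]; rewrite !inE /=.
    apply/negP => xy; have : x \in S :\ v.
      by rewrite !inE (rS _ _ xy) andbT; apply: contraTneq xy => ->; rewrite vN.
    by rewrite S1 inE.
  have := IHn r (S :\ v); rewrite (_ : _ < n = true); last by lia.
  move=> /(_ isT rs ri); rewrite -card_gt0 => /(_ _ c0 vk) h.
  suff: #|arcs r|.+2 < 6 * #|S :\ v| by lia.
  apply: h => x y xy; rewrite !inE (rS _ _ xy) andbT.
  by apply: contraTneq xy => ->; rewrite vN.
move=> d0; have [|w vw cw] := @van_kampen_nbr r v rs ri vk; first by rewrite d0.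
have wv : w != v by apply: contraTneq vw => ->; rewrite ri.
have wS : w \in S by move: vw; rewrite rs => /rS.
have := contract_arcs rs ri vw.
have := IHn (contract r v w) (S :\ v); rewrite (_ : _ < n = true); last by lia.
move=> /(_ isT (contract_sym _ _ rs) (@contract_irr _ _ _)) h.
suff: #|arcs (contract r v w)|.+2 < 6 * #|S :\ v| by lia.
apply: h; last exact: contract_van_kampen.
  move=> x y /and4P[xv _ _]; rewrite !inE xv /=.
  case/or3P=> [/rS//|/andP[/eqP->]//|/andP[_]]; by rewrite rs => /rS.
by apply/set0Pn; exists w; rewrite !inE wv.
Qed.

End Sparse.

(** * Counting square-neighbours inside a vertex set *)

Section Near.
Variables (V : finType) (r : rel V) (D : nat).
Hypotheses (rs : symmetric r) (ri : irreflexive r).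
Hypothesis (degD : forall x, #|nbr r x| <= D).
Implicit Types (S : {set V}) (H : rel V).

Definition near : rel V :=
  [rel x y | (x != y) && (r x y || [exists w, r x w && r w y])].

Lemma edge_neq x y : r x y -> x != y.
Proof. by apply: contraTneq => <-; rewrite ri. Qed.

Lemma card_nbrD1 (A : {set V}) v w : v \in A -> r v w ->
  #|(nbr r w :&: A) :\ v| <= D.-1.
Proof.
move=> vA vw; have := cardsD1 v (nbr r w :&: A); rewrite !inE vA rs vw /=.
have := subset_leq_card (subsetIl (nbr r w) A); have := degD w; lia.
Qed.

Lemma near_card_sqr v : #|[set x | near v x]| <= D ^ 2.
Proof.
have sub : [set x | near v x] \subset
    nbr r v :|: \bigcup_(w in nbr r v) ((nbr r w :&: setT) :\ v).
  apply/subsetP => x; rewrite !inE => /andP[vx /orP[->//|/existsP[w /andP[vw wx]]]].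
  by apply/orP; right; apply/bigcupP; exists w; rewrite !inE ?vw // eq_sym vx wx.
apply: leq_trans (subset_leq_card sub) _.
apply: leq_trans (leq_card_setU _ _) _.
have : \sum_(w in nbr r v) #|(nbr r w :&: setT) :\ v| <= #|nbr r v| * D.-1.
  rewrite -sum_nat_const; apply: leq_sum => w; rewrite inE => vw.
  by apply: card_nbrD1; rewrite ?inE.
have := card_bigcup_leq (nbr r v) (fun w => (nbr r w :&: setT) :\ v).
have := degD v; nia.
Qed.

Lemma sum_nbr_exchange (A B : {set V}) (f : V -> nat) :
  \sum_(v in A) \sum_(u in nbr r v :&: B) f u =
  \sum_(u in B) #|nbr r u :&: A| * f u.
Proof.
rewrite (exchange_big_dep (mem B)) /=; last by move=> v u _; rewrite !inE => /andP[].
apply: eq_bigr => u uB; rewrite -sum_nat_const; apply: eq_bigl => v.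
by rewrite !inE uB andbT rs andbC.
Qed.

(** * The average square-degree for maximum degree at least 6 *)

Section Average.
Variable S : {set V}.
Hypotheses (D6 : 6 <= D) (S0 : S != set0) (vk : van_kampen r).

Let dS u := #|nbr r u :&: S|.
Let T3 := [set u | (u \notin S) && (dS u <= 3)].
Let T4 := [set u | (u \notin S) && (3 < dS u)].

Definition fill : rel V := [rel x y | (x != y) &&
  [|| [&& x \in S, y \in S & r x y || [exists u in T3, r u x && r u y]],
      [&& x \in S, y \in T4 & r x y] | [&& x \in T4, y \in S & r x y]]].

Lemma fill_sym : symmetric fill.
Proof.
move=> x y; rewrite /fill /= eq_sym rs.
have -> : [exists u in T3, r u x && r u y] = [exists u in T3, r u y && r u x].
  by apply: eq_existsb => u; rewrite [r u x && _]andbC.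
by case: (x \in S); case: (y \in S); case: (x \in T4); case: (y \in T4);
  rewrite /= ?orbF ?orbb.
Qed.

(** Two independent new edges routed through the same deleted vertex would give it four neighbours
    in [S], while those in [T3] have at most three. *)
Lemma fill_van_kampen : van_kampen fill.
Proof.
have newS x y : fill x y -> ~~ r x y ->
    [&& x \in S, y \in S & [exists u in T3, r u x && r u y]].
  by move=> /andP[_ +] /negPf nr; rewrite nr !andbF !orbF.
apply: (van_kampen_reroute (W := T3)) vk.
- move=> x y /andP[_ /or3P[] /and3P[]]; rewrite !inE.
  + by move=> -> ->.
  + by move=> -> /andP[-> dy] _ /=; rewrite -ltnNge dy.
  + by move=> /andP[-> dx] -> _ /=; rewrite -ltnNge dx.
- by move=> x y f /(newS _ _ f)/and3P[_ _ /exists_inP].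
- move=> u x y k l uT fxy fkl nxy nkl ux uy uk ul U.
  have /and3P[xS yS _] := newS _ _ fxy nxy.
  have /and3P[kS lS _] := newS _ _ fkl nkl.
  have : 4 <= dS u.
    rewrite /dS cardE; apply: (uniq_leq_size (s1 := [:: x; y; k; l]) U) => z.
    rewrite mem_enum !inE => /or4P[] /eqP->;
      by rewrite ?ux ?uy ?uk ?ul ?xS ?yS ?kS ?lS.
  by move=> d4; move: uT; rewrite inE leqNgt d4 andbF.
Qed.

(** A square-neighbour reached by an edge or through [T3] is a neighbour in [fill]. One reached
    through [S] passes by a neighbour of [v] that is itself a neighbour in [fill] and leads to at
    most D - 1 vertices; these kinds together account for the factor [D]. The sum covers paths
    through [T4]. *)
Lemma near_card_fill v : v \in S ->
  #|[set x in S | near v x]| <=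
    D * #|nbr fill v :&: S| + \sum_(u in nbr r v :&: T4) (dS u).-1.
Proof.
move=> vS.
have sub : [set x in S | near v x] \subset (nbr fill v :&: S) :|:
    \bigcup_(w in nbr r v :&: S) ((nbr r w :&: S) :\ v) :|:
    \bigcup_(w in nbr r v :&: T4) ((nbr r w :&: S) :\ v).
  apply/subsetP => x; rewrite !inE => /and3P[xS vx].
  case/orP=> [rvx|/existsP[w /andP[vw wx]]]; first by rewrite /fill /= vS xS vx rvx.
  have [wS|wS] := boolP (w \in S).
    apply/orP; left; apply/orP; right; apply/bigcupP; exists w.
      by rewrite !inE vw.
    by rewrite !inE wx xS eq_sym vx.
  have [d3|d4] := leqP (dS w) 3.
    apply/orP; left; apply/orP; left; rewrite /fill /= xS vx vS /=.
    rewrite andbT; apply/orP; left; apply/orP; right.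
    by apply/exists_inP; exists w; rewrite ?inE ?wS ?d3 // rs vw.
  apply/orP; right; apply/bigcupP; exists w; first by rewrite !inE vw wS.
  by rewrite !inE wx xS eq_sym vx.
apply: leq_trans (subset_leq_card sub) _.
apply: leq_trans (leq_card_setU _ _) _; apply: leq_add; last first.
  apply: leq_trans (card_bigcup_leq _ _) _; apply: leq_sum => u.
  rewrite !inE => /andP[vu _]; have := cardsD1 v (nbr r u :&: S).
  by rewrite !inE vS rs vu /dS; lia.
apply: leq_trans (leq_card_setU _ _) _.
have : #|nbr r v :&: S| <= #|nbr fill v :&: S|.
  apply/subset_leq_card/subsetP => x; rewrite !inE => /andP[vx xS].
  by rewrite /fill /= vS xS vx (edge_neq vx).
have : \sum_(w in nbr r v :&: S) #|(nbr r w :&: S) :\ v| <= #|nbr r v :&: S| * D.-1.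
  rewrite -sum_nat_const; apply: leq_sum => w; rewrite !inE => /andP[vw _].
  exact: card_nbrD1.
have := card_bigcup_leq (nbr r v :&: S) (fun w => (nbr r w :&: S) :\ v).
nia.
Qed.

Lemma near_average : exists2 v, v \in S & #|[set x in S | near v x]| < 6 * D.
Proof.
have [/exists_inP//|/exists_inPn no] :=
  boolP [exists v in S, #|[set x in S | near v x]| < 6 * D].
exfalso; pose a := \sum_(v in S) #|nbr fill v :&: S|.
pose d := \sum_(u in T4) dS u; pose q := \sum_(u in T4) dS u * (dS u).-1.
have low : 6 * D * #|S| <= D * a + q.
  have -> : q = \sum_(v in S) \sum_(u in nbr r v :&: T4) (dS u).-1.
    by rewrite sum_nbr_exchange.
  rewrite mulnC -sum_nat_const /a big_distrr -big_split /=.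
  apply: leq_sum => v vS; apply: leq_trans _ (near_card_fill vS).
  by rewrite leqNgt; apply: no.
(* The edge bound for [fill] on the union of [S] and [T4]; the edges between the two sets contribute
   [d] arcs in each direction. *)
have up : (a + d + d).+2 < 6 * (#|S| + #|T4|).
  have ST : #|S :|: T4| = #|S| + #|T4|.
    rewrite cardsU (_ : S :&: T4 = set0) ?cards0 ?subn0 //.
    by apply/setP => x; rewrite !inE; case: (x \in S).
  rewrite -ST; apply: leq_ltn_trans (van_kampen_sparse fill_sym _ _ _ fill_van_kampen).
  - rewrite !ltnS card_arcs (bigID (mem S)) /=; apply: leq_add.
      have -> : d = \sum_(v in S) #|nbr r v :&: T4|.
        transitivity (\sum_(u in T4) #|nbr r u :&: S| * 1).
          by apply: eq_bigr => u _; rewrite muln1.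
        by rewrite -sum_nbr_exchange; apply: eq_bigr => v _; rewrite sum1_card.
      rewrite -big_split /=; apply: leq_sum => v vS.
      rewrite -(cardsID S (nbr fill v)) leq_add2l.
      apply/subset_leq_card/subsetP => x; rewrite !inE /fill /= => /and3P[vx xS xd].
      have xT : x \in T4 by rewrite inE xS.
      by rewrite xS vS xT vx edge_neq //= orbT.
    rewrite [X in _ <= X](bigID (mem T4)) /=; apply: leq_trans (leq_addr _ _).
    rewrite [X in X <= _](eq_bigl (fun u => (u \notin S) && (u \in T4))); last first.
      by move=> u; rewrite !inE; case: (u \in S).
    apply: leq_sum => u /andP[uS uT]; apply/subset_leq_card/subsetP => x.
    rewrite !inE /fill /= => /andP[ux xS]; by rewrite xS ux uT (edge_neq ux) (negPf uS).
  - by move=> x; rewrite /fill /= eqxx.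
  - by move=> x y /andP[_ /or3P[] /and3P[h1 h2 _]]; rewrite in_setU ?h1 ?orbT.
  - by apply: contra S0; rewrite setU_eq0 => /andP[].
(* For each [u] in [T4] this says k(k - 1) + 6D <= 2Dk for 4 <= k <= D. By convexity in k the
   endpoints suffice; k = 4 requires D >= 6. Together with [low] and D times [up] this is
   contradictory. *)
have key : q + 6 * D * #|T4| <= 2 * D * d.
  rewrite mulnC -sum_nat_const -big_split /= /d big_distrr /=; apply: leq_sum => u.
  rewrite inE => /andP[_]; have := degD u.
  have := subset_leq_card (subsetIl (nbr r u) S); rewrite -/(dS u).
  by move: (dS u) => k; nia.
nia.
Qed.

End Average.

(* [H] is what remains on [S] after the vertices outside [S] have been contracted
   into [S] one at a time. *)
Definition reduced S H : Prop :=
  [/\ symmetric H, irreflexive H, van_kampen H,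
      (forall x y, H x y -> x \in S) & (forall x y, x \in S -> y \in S -> r x y -> H x y)] /\
  (forall u v, u \notin S -> v \in S -> r u v ->
     #|[set x in S | [&& r u x, x != v & ~~ H v x]]| <= 3).

(** The vertex removed has degree at most 5 in [H]. Its square-neighbours are its neighbours in [H],
    those reached through [S], and at most 3 more for each neighbour outside [S], by the last clause
    of [reduced]. *)
Lemma reduced_step S H : 4 <= D -> S != set0 -> reduced S H ->
  exists v, [/\ v \in S, #|[set x in S | near v x]| + 15 <= 8 * D &
                exists H', reduced (S :\ v) H'].
Proof.
move=> D4 S0 [[Hs Hi Hvk HS rH] Hu].
have [v vS dv] : exists2 v, v \in S & #|nbr H v| <= 5.
  have [/exists_inP//|/exists_inPn no] := boolP [exists v in S, #|nbr H v| <= 5].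
  have := van_kampen_sparse Hs Hi HS S0 Hvk.
  suff: 6 * #|S| <= #|arcs H| by lia.
  rewrite card_arcs mulnC -sum_nat_const [X in _ <= X](bigID (mem S)) /=.
  apply: leq_trans (leq_addr _ _); apply: leq_sum => x xS.
  by rewrite ltnNge; apply: no.
exists v; split=> //.
  have sub : [set x in S | near v x] \subset nbr H v :|:
      \bigcup_(w in nbr r v :&: S) ((nbr r w :&: S) :\ v) :|:
      \bigcup_(u in nbr r v :\: S) [set x in S | [&& r u x, x != v & ~~ H v x]].
    apply/subsetP => x; rewrite !inE => /and3P[xS vx].
    have [Hvx|nH] := boolP (H v x); first by [].
    case/orP=> [/(rH _ _ vS xS)|/existsP[w /andP[vw wx]]]; first by rewrite (negPf nH).
    have [wS|wS] := boolP (w \in S).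
      apply/orP; left; apply/bigcupP; exists w; first by rewrite !inE vw.
      by rewrite !inE wx xS eq_sym vx.
    apply/orP; right; apply/bigcupP; exists w; first by rewrite !inE vw wS.
    by rewrite !inE wx xS eq_sym vx.
  have b5 : #|nbr r v :&: S| <= 5.
    apply: leq_trans dv; apply/subset_leq_card/subsetP => x; rewrite !inE.
    by case/andP=> vx xS; apply: rH.
  have s1 : \sum_(w in nbr r v :&: S) #|(nbr r w :&: S) :\ v| <= #|nbr r v :&: S| * D.-1.
    rewrite -sum_nat_const; apply: leq_sum => w; rewrite !inE => /andP[vw _].
    exact: card_nbrD1.
  have s2 : \sum_(u in nbr r v :\: S) #|[set x in S | [&& r u x, x != v & ~~ H v x]]|
      <= #|nbr r v :\: S| * 3.
    rewrite -sum_nat_const; apply: leq_sum => u; rewrite !inE => /andP[uS vu].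
    by apply: Hu => //; rewrite rs.
  (* The extreme case is 5 neighbours inside [S] and D - 5 outside: 5(D - 1) + 3(D - 5) = 8D - 20.
     The at most 5 neighbours in [H] bring the total to 8D - 15. *)
  have bt : #|nbr r v :&: S| * D.-1 + #|nbr r v :\: S| * 3 + 20 <= 8 * D.
    have := degD v; rewrite -(cardsID S (nbr r v)); move: b5.
    by case: #|_ :&: S| => [|[|[|[|[|[|//]]]]]]; lia.
  suff: #|[set x in S | near v x]| <=
      5 + #|nbr r v :&: S| * D.-1 + #|nbr r v :\: S| * 3 by lia.
  apply: leq_trans (subset_leq_card sub) _; apply: leq_trans (leq_card_setU _ _) _.
  apply: leq_add; last exact: leq_trans (card_bigcup_leq _ _) s2.
  apply: leq_trans (leq_card_setU _ _) _; apply: leq_add dv _.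
  exact: leq_trans (card_bigcup_leq _ _) s1.
have old u y H' : (forall a b, a != v -> b != v -> H a b -> H' a b) ->
    u \notin S -> y \in S :\ v -> r u y ->
    #|[set x in S :\ v | [&& r u x, x != y & ~~ H' y x]]| <= 3.
  move=> sH uS; rewrite !inE => /andP[yv yS] uy.
  apply: leq_trans (Hu u y uS yS uy); apply/subset_leq_card/subsetP => x.
  rewrite !inE => /andP[/andP[xv ->] /and3P[-> -> n]] /=.
  by apply: contra n; apply: sH.
have out u : u \notin S :\ v -> u = v \/ u \notin S.
  by rewrite !inE negb_and negbK => /orP[/eqP|]; [left|right].
have [/eqP|] := posnP #|nbr H v|.
  rewrite cards_eq0 => /eqP n0; have vN x : H v x = false.
    by have /setP/(_ x) := n0; rewrite !inE.
  exists H; split; first split=> //.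
  - move=> x y xy; rewrite !inE (HS _ _ xy) andbT.
    by apply: contraTneq xy => ->; rewrite vN.
  - by move=> x y; rewrite !inE => /andP[_ xS] /andP[_ yS]; apply: rH.
  move=> u y /out[->|uS yS uy]; last exact: old.
  by rewrite !inE => /andP[_ yS] vy; have := rH _ _ vS yS vy; rewrite vN.
move/card_gt0P=> [w]; rewrite inE => vw.
have wv : w != v by apply: contraTneq vw => ->; rewrite Hi.
have wS : w \in S by move: vw; rewrite Hs => /HS.
have HN x y : H x y -> x != y by apply: contraTneq => <-; rewrite Hi.
exists (contract H v w); split; first split.
- exact: contract_sym.
- exact: contract_irr.
- exact: contract_van_kampen.
- move=> x y /and4P[xv _ _]; rewrite !inE xv /=.
  case/or3P=> [/HS//|/andP[/eqP->]//|/andP[_]]; by rewrite Hs => /HS.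
- move=> x y; rewrite !inE => /andP[xv xS] /andP[yv yS] xy.
  have Hxy := rH _ _ xS yS xy.
  by rewrite /contract /= xv yv Hxy HN.
move=> u y /out[->|uS yS uy]; last first.
  by apply: old => // a b av bv ab; rewrite /contract /= av bv ab HN.
rewrite !inE => /andP[yv yS] vy; have Hvy := rH _ _ vS yS vy.
have [->|yw] := eqVneq y w.
  rewrite (_ : [set x in _ | _] = set0) ?cards0 //; apply/setP => x; rewrite !inE.
  apply/negP => /andP[/andP[xv xS] /and3P[vx xw]].
  by rewrite /contract /= wv xv [w == x]eq_sym xw eqxx (rH _ _ vS xS vx) orbT.
(* The contraction makes [w] adjacent to every other former neighbour of [v], in particular to [y].
   So of the at most 5 neighbours of [v], only those other than [y] and [w] can be missed by [y]. *)
have : #|(nbr H v :\ y) :\ w| <= 3.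
  have := cardsD1 y (nbr H v); have := cardsD1 w (nbr H v :\ y).
  by rewrite !inE Hvy vw eq_sym yw /= => -> e; move: dv; rewrite e.
apply: leq_trans; apply/subset_leq_card/subsetP => x; rewrite !inE.
case/andP=> /andP[xv xS] /and3P[vx xy n]; rewrite xy (rH _ _ vS xS vx) !andbT.
apply: contra n => /eqP->.
by rewrite /contract /= yv wv yw eqxx Hvy !orbT.
Qed.

Lemma reduced_setT : van_kampen r -> reduced setT r.
Proof. by move=> vk; split; [split|move=> u v; rewrite inE]. Qed.

End Near.

(** * Degeneracy orders and list colouring *)

Inductive elimination (V : finType) (e : rel V) (k : nat) : {set V} -> Prop :=
| elimination0 : elimination e k set0
| eliminationS (S : {set V}) v : v \in S -> #|[set x in S | e v x]| < k ->
    elimination e k (S :\ v) -> elimination e k S.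

(** Greedy colouring in the reverse order of elimination: the fewer than [k] coloured neighbours of
    the vertex put back leave a colour in its list. *)
Lemma elimination_choosable (G : sgraph) (e : rel G) k : 0 < k ->
  subrel (@edge G) e -> elimination e k setT -> choosable G k.
Proof.
move=> k0 sub el C L szL.
suff [c [cL cE]] : exists c : G -> C, (forall x, c x \in L x) /\
    (forall x y, x \in setT -> y \in setT -> edge x y -> c x != c y).
  by exists c; split=> // x y; apply: cE; rewrite inE.
elim: el => [|S v vS lt _ [c [cL cE]]].
  have Lex x : exists a, a \in L x by apply/card_gt0P; rewrite szL.
  exists (fun x => xchoose (Lex x)); split=> [x|x y]; last by rewrite inE.
  exact: xchooseP.
have /card_gt0P[a] : 0 < #|L v :\: [set c x | x in [set x in S | e v x]]|.
  rewrite cardsD szL subn_gt0; apply: leq_ltn_trans lt.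
  exact: leq_trans (subset_leq_card (subsetIr _ _)) (leq_imset_card _ _).
rewrite inE => /andP[aN aL].
have ac x : x \in S -> edge v x -> a != c x.
  move=> xS vx; apply: contraNneq aN => ->; apply: imset_f.
  by rewrite inE xS sub.
exists (fun x => if x == v then a else c x); split=> [x|x y xS yS xy].
  by case: eqP => [->|].
case: (eqVneq x v) xy => [->|xv]; case: (eqVneq y v) => [->|yv] xy.
- by rewrite edge_irrefl in xy.
- exact: ac.
- by rewrite eq_sym; apply: ac; rewrite // edge_sym.
- by apply: cE; rewrite ?inE ?xv ?yv.
Qed.

Lemma list_chromatic_leq (G : sgraph) k : choosable G k -> list_chromatic_number G <= k.
Proof.
by move=> ck; rewrite /list_chromatic_number; case: ex_minnP => m _; apply;
   apply/boolp.asboolP.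
Qed.

Lemma square_edge_near (G : sgraph) : subrel (@edge (square G)) (near (@edge G)).
Proof.
have walk0 (x : G) : walk 0 x x by apply/existsP; exists [tuple]; rewrite /= eqxx.
move=> x y sxy; apply/andP; split.
  by apply: contraTneq sxy => ->; rewrite edge_irrefl.
case/orP: sxy => /andP[/existsP[p /andP[]]].
  case: p => [[|a []] //= _]; rewrite andbT => xa /eqP <- _; by rewrite xa.
case: p => [[|a [|b []]] //= _]; rewrite andbT => /andP[xa ab] /eqP <- _.
by apply/orP; right; apply/existsP; exists a; rewrite xa ab.
Qed.

Lemma elimination_hereditary (V : finType) (e : rel V) k :
  (forall S : {set V}, S != set0 -> exists2 v, v \in S & #|[set x in S | e v x]| < k) ->
  forall S, elimination e k S.
Proof.
move=> small S; have [n] := ubnP #|S|; elim: n S => // n IH S lt_n.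
have [->|S0] := eqVneq S set0; first exact: elimination0.
have [v vS lt] := small S S0; apply: (eliminationS vS lt); apply: IH.
by move: lt_n; rewrite (cardsD1 v) vS.
Qed.

Lemma van_kampen_square (G : sgraph) : van_kampen (@edge G) ->
  (max_degree G <= 5 ->
     list_chromatic_number (square G) <= max_degree G ^ 2 + 1) /\
  (6 <= max_degree G ->
     list_chromatic_number (square G) <= 7 * max_degree G - 7).
Proof.
move=> vk; set D := max_degree G.
have degD (x : G) : #|nbr (@edge G) x| <= D.
  rewrite /D /max_degree; apply: leq_trans (leq_bigmax x).
  by rewrite cardsE.
have [rs ri] := (@edge_sym G, @edge_irrefl G).
have fin k : 0 < k -> elimination (near (@edge G)) k setT ->
    list_chromatic_number (square G) <= k.
  move=> k0 el; apply: list_chromatic_leq.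
  exact: (@elimination_choosable (square G) _ k k0 (@square_edge_near G) el).
split=> [_|D6].
  apply: fin; rewrite ?addn1 //; apply: elimination_hereditary => S /set0Pn[v vS].
  exists v; rewrite // ltnS; apply: leq_trans (near_card_sqr rs degD v).
  by apply/subset_leq_card/subsetP => x; rewrite !inE => /andP[].
(* For D >= 7 the average bound suffices since 6D <= 7D - 7. For D = 6 it does not, as 36 > 35, but
   [reduced_step] gives at most 33 square-neighbours. *)
case: (ltngtP D 6) => [|D7|D6']; first lia.
  apply: fin; first lia.
  apply: elimination_hereditary => S S0.
  have [v vS lt] := near_average rs ri degD D6 S0 vk; exists v => //; lia.
apply: fin; first lia.
have [H red] : exists H, reduced (@edge G) setT H.
  by exists (@edge G); apply: reduced_setT.
move: setT H red => S; have [n] := ubnP #|S|; elim: n S => // n IH S lt_n H red.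
have [->|S0] := eqVneq S set0; first exact: elimination0.
have [v [vS lt [H' red']]] := reduced_step rs degD (leq_trans (isT : 4 <= 6) D6) S0 red.
apply: (eliminationS vS); first lia.
by apply: IH red'; move: lt_n; rewrite (cardsD1 v) vS.
Qed.


(* Plane geometry: ray-crossing parities solve the system *)
From mathcomp Require Import boolp classical_sets.
Import Order.TTheory GRing.Theory Num.Theory.

Section Lex.
Local Open Scope ring_scope.
Variable R : realType.
Notation point := 'rV[R]_2.
Implicit Types (a b p q u v : point).

Definition px p : R := p 0 0.
Definition py p : R := p 0 1.

(* Heights are compared lexicographically, [y] first, which amounts to an
   infinitesimal shear putting the finitely many points at distinct heights. *)
Definition lexpos v := (0 < py v) || (py v == 0) && (0 < px v).
Definition lexlt p q := lexpos (q - p).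
Definition cross u v := px u * py v - py u * px v.

Lemma pointP p q : px p = px q -> py p = py q -> p = q.
Proof.
move=> hx hy; apply/rowP; case=> [[|[|//]] i]; [move: hx|move: hy];
  by rewrite /px /py => h; congr (_ = _): h; congr (_ _ _); apply: val_inj.
Qed.

Lemma pxD u v : px (u + v) = px u + px v. Proof. by rewrite /px mxE. Qed.
Lemma pyD u v : py (u + v) = py u + py v. Proof. by rewrite /py mxE. Qed.
Lemma pxN u : px (- u) = - px u. Proof. by rewrite /px mxE. Qed.
Lemma pyN u : py (- u) = - py u. Proof. by rewrite /py mxE. Qed.
Lemma pxZ k u : px (k *: u) = k * px u. Proof. by rewrite /px mxE. Qed.
Lemma pyZ k u : py (k *: u) = k * py u. Proof. by rewrite /py mxE. Qed.
Definition pE := (pxD, pyD, pxN, pyN, pxZ, pyZ).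

Lemma lexposP v : reflect (0 < py v \/ py v = 0 /\ 0 < px v) (lexpos v).
Proof.
apply: (iffP orP) => [[?|/andP[/eqP ? ?]]|[?|[/eqP ? ?]]]; [left|right|left|right] => //.
exact/andP.
Qed.

Lemma lexposD u v : lexpos u -> lexpos v -> lexpos (u + v).
Proof.
by move=> /lexposP[?|[? ?]] /lexposP[?|[? ?]]; apply/lexposP; rewrite !pE; lra.
Qed.

Lemma lexposZ k u : 0 < k -> lexpos (k *: u) = lexpos u.
Proof. by move=> k0; rewrite /lexpos !pE !pmulr_rgt0 // mulf_eq0 gt_eqF. Qed.

Lemma lexposN u : lexpos u -> ~~ lexpos (- u).
Proof. by move=> /lexposP ?; apply/lexposP; rewrite !pE; lra. Qed.

Lemma lexposVN u : u != 0 -> lexpos (- u) = ~~ lexpos u.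
Proof.
move=> u0; apply/idP/idP => [/lexposN|]; first by rewrite opprK.
rewrite /lexpos !pE !oppr_gt0 oppr_eq0.
case: (ltgtP (py u) 0) => //= uy; case: (ltgtP (px u) 0) => //= ux.
by case/eqP: u0; apply: pointP; rewrite ?ux ?uy /px /py mxE.
Qed.

Lemma lexlt_asym p q : p != q -> lexlt q p = ~~ lexlt p q.
Proof. by move=> pq; rewrite /lexlt -lexposVN ?opprB // subr_eq0 eq_sym. Qed.

(** Twice the signed area of the triangle [a b p]. *)
Definition orient a b p := cross (b - a) (p - a).


Lemma lexlt_trans q p u : lexlt p q -> lexlt q u -> lexlt p u.
Proof. by rewrite /lexlt => pq qu; rewrite -(subrKA q) addrC lexposD // addrC. Qed.

Lemma lexltxx p : lexlt p p = false.
Proof. by rewrite /lexlt subrr /lexpos /px /py !mxE ltxx andbF. Qed.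

Lemma lexltF p q : lexlt p q -> lexlt q p = false.
Proof.
by move=> pq; apply/negP => qp; have := lexlt_trans pq qp; rewrite lexltxx.
Qed.

Lemma lexltNge p q : p != q -> ~~ lexlt p q -> lexlt q p.
Proof. by move/lexlt_asym->. Qed.

Lemma segmentE p q t : (1 - t) *: p + t *: q = p + t *: (q - p).
Proof. by rewrite scalerBl scale1r scalerBr addrAC addrA. Qed.

Lemma segment_l p q : segment p q p.
Proof. by exists 0; rewrite ?lexx ?ler01 // subr0 scale1r scale0r addr0. Qed.

Lemma segment_r p q : segment p q q.
Proof. by exists 1; rewrite ?lexx ?ler01 // subrr scale1r scale0r add0r. Qed.

Lemma lexlt_convex (a b : point) t : lexlt a b -> 0 <= t <= 1 ->
  forall c, lexlt a c -> lexlt a ((1 - t) *: b + t *: c).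
Proof.
move=> ab /andP[t0 t1] c ac; rewrite /lexlt.
have -> : (1 - t) *: b + t *: c - a = (1 - t) *: (b - a) + t *: (c - a).
  by apply: pointP; rewrite !pE; ring.
have [->|tn0] := eqVneq t 0; first by rewrite subr0 scale1r scale0r addr0.
have [->|tn1] := eqVneq t 1; first by rewrite subrr scale1r scale0r add0r.
by apply: lexposD; rewrite lexposZ // ?subr_gt0 lt_neqAle ?tn1 // eq_sym tn0.
Qed.

Lemma lexgt_convex (a b : point) t : lexlt b a -> 0 <= t <= 1 ->
  forall c, lexlt c a -> lexlt ((1 - t) *: b + t *: c) a.
Proof.
move=> ba /andP[t0 t1] c ca; rewrite /lexlt.
have -> : a - ((1 - t) *: b + t *: c) = (1 - t) *: (a - b) + t *: (a - c).
  by apply: pointP; rewrite !pE; ring.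
have [->|tn0] := eqVneq t 0; first by rewrite subr0 scale1r scale0r addr0.
have [->|tn1] := eqVneq t 1; first by rewrite subrr scale1r scale0r add0r.
by apply: lexposD; rewrite lexposZ // ?subr_gt0 lt_neqAle ?tn1 // eq_sym tn0.
Qed.

Lemma orient_between a b p : lexlt a p -> lexlt p b -> orient a b p = 0 ->
  segment a b p.
Proof.
move=> ap pb o0; have /lexposP := lexlt_trans ap pb.
move: o0 ap pb; rewrite /lexlt /orient /cross => + /lexposP + /lexposP; rewrite !pE.
move=> o0 ap pb [dy|[dy dx]].
  (* The parameter is the ratio of heights, or below, for a horizontal segment, that of
     abscissae. *)
  exists ((py p - py a) / (py b - py a)).
    by rewrite ler_pdivlMr // ler_pdivrMr //; apply/andP; split; lra.
  rewrite segmentE; apply: pointP; rewrite !pE; last by field; lra.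
  apply: (mulIf (lt0r_neq0 dy)); rewrite mulrDl mulrAC divfK ?lt0r_neq0 //; lra.
exists ((px p - px a) / (px b - px a)).
  by rewrite ler_pdivlMr // ler_pdivrMr //; apply/andP; split; lra.
rewrite segmentE; apply: pointP; rewrite !pE; first by field; lra.
have -> : py b - py a = 0 by [].
rewrite mulr0 addr0; lra.
Qed.

(** x / (x - y) is the zero of the affine function with value [x] at 0 and [y] at 1. *)
Lemma ratio01 (x y : R) : x * y < 0 -> x - y != 0 /\ 0 <= x / (x - y) <= 1.
Proof.
move=> xy; have D0 : x - y != 0.
  by apply: contraTneq xy => /subr0_eq->; rewrite -leNgt -expr2 sqr_ge0.
split=> //; have D2 : 0 < (x - y) ^+ 2 by rewrite exprn_even_gt0.
have -> : x / (x - y) = x * (x - y) / (x - y) ^+ 2 by field.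
by rewrite ler_pdivlMr // ler_pdivrMr //; apply/andP; split; nra.
Qed.

Lemma orient_cross a b p q : orient a b p * orient a b q < 0 ->
  exists2 t, 0 <= t <= 1 & orient a b ((1 - t) *: p + t *: q) = 0.
Proof.
set A := orient a b p; set B := orient a b q => /ratio01[D0 t01].
exists (A / (A - B)) => //.
rewrite segmentE; transitivity (A + A / (A - B) * (B - A)); last by field.
by rewrite /A /B /orient /cross !pE; ring.
Qed.

Lemma cross_segments a b p q :
  orient a b p * orient a b q < 0 -> orient p q a * orient p q b < 0 ->
  exists2 z, segment a b z & segment p q z.
Proof.
set A := orient a b p; set A' := orient a b q.
set C := orient p q a; set C' := orient p q b.
move=> /ratio01[D0 t01] /ratio01[E0 s01].
(* Both differences are, up to sign, the cross product of the two directions; this makes the zeros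
   on the two segments the same point. *)
have DE : A - A' = - (C - C') by rewrite /A /A' /C /C' /orient /cross !pE; ring.
exists ((1 - A / (A - A')) *: p + (A / (A - A')) *: q); last by exists (A / (A - A')).
exists (C / (C - C')) => //.
have key : A *: (q - p) + (A - A') *: (p - a) = (- C) *: (b - a).
  by apply: pointP; rewrite !pE /A /A' /C /orient /cross !pE; ring.
apply: (scalerI D0); rewrite !segmentE [LHS]scalerDr [RHS]scalerDr !scalerA.
have -> : (A - A') * (A / (A - A')) = A by field.
have -> : (A - A') * (C / (C - C')) = - C by rewrite DE; field.
rewrite -key; apply: pointP; rewrite !pE; ring.
Qed.

Lemma lexpos_comb (x y z : R) u v w : 0 < x -> 0 < y -> 0 <= z ->
  lexpos u -> lexpos v -> lexpos w -> x *: u + y *: v + z *: w != 0.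
Proof.
move=> x0 y0 z0 pu pv pw; suff: lexpos (x *: u + y *: v + z *: w).
  by apply: contraTneq => ->; rewrite -(subrr u) [lexpos _]lexltxx.
have xy : lexpos (x *: u + y *: v) by rewrite lexposD ?lexposZ.
have [->|zn0] := eqVneq z 0; first by rewrite scale0r addr0.
by rewrite lexposD ?lexposZ // lt_neqAle eq_sym zn0.
Qed.

(** Two linear relations among differences of the four points have lexicographically positive
    vectors, so their coefficients cannot all be nonnegative. This forces [q] to the other side of
    [a b] and [a] to the other side of [p q]. *)
Lemma interleaved_cross a b p q k : lexlt a p -> lexlt p b -> lexlt b q ->
  0 < k * orient a b p -> 0 < k * orient p q b ->
  exists2 z, segment a b z & segment p q z.
Proof.
move=> ap pb bq kA kC; have ab := lexlt_trans ap pb; have pq := lexlt_trans pb bq.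
have kA' : k * orient a b q < 0.
  rewrite ltNge; apply/negP => kA'; move: (lexpos_comb kA kC kA' bq ab pb).
  by case/eqP; apply: pointP; rewrite !pE /orient /cross !pE /px /py !mxE; ring.
have kC' : k * orient p q a < 0.
  rewrite ltNge; apply/negP => kC'; move: (lexpos_comb kA kC kC' pq ap pb).
  by case/eqP; apply: pointP; rewrite !pE /orient /cross !pE /px /py !mxE; ring.
have k0 : 0 < k ^+ 2 by rewrite exprn_even_gt0 //=; apply: contraTneq kA => ->; rewrite mul0r ltxx.
apply: cross_segments; rewrite -(pmulr_rlt0 _ k0).
  by rewrite expr2 mulrACA nmulr_llt0.
by rewrite expr2 mulrACA nmulr_rlt0.
Qed.

(* The horizontal ray from [p] towards increasing [x] meets the segment [a, b]. *)
Definition leftb a b p :=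
  (lexlt a p && lexlt p b && (0 < orient a b p)) ||
  (lexlt b p && lexlt p a && (0 < orient b a p)).

Lemma leftbC a b p : leftb a b p = leftb b a p.
Proof. exact: orbC. Qed.

Lemma leftb_segments_lt a b p q : lexlt a b -> lexlt p q -> lexlt a p ->
  (forall z, segment a b z -> segment p q z -> False) ->
  leftb a b p (+) leftb a b q (+) leftb p q a (+) leftb p q b =
  lexlt p a (+) lexlt q a (+) lexlt p b (+) lexlt q b.
Proof.
move=> ab pq ap disj; have aq := lexlt_trans ap pq.
rewrite /leftb ?ap ?aq ?(lexltF ap) ?(lexltF aq) /= ?andbF ?orbF /=.
have bp : b != p.
  by apply/eqP => bp; apply: (disj b); [exact: segment_r | rewrite bp; exact: segment_l].
have bq : b != q.
  by apply/eqP => bq; apply: (disj b); [exact: segment_r | rewrite bq; exact: segment_r].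
have [pb|/(lexltNge _) bltp] := boolP (lexlt p b); last first.
  have {bltp} bltp : lexlt b p by apply: bltp; rewrite eq_sym.
  by rewrite !(lexltF (lexlt_trans bltp pq)).
rewrite (lexltF pb) /= ?andbF ?orbF.
have onp : orient a b p != 0.
  by apply/eqP => /(orient_between ap pb) s; apply: (disj p) s (segment_l _ _).
have [qb|/(lexltNge _) bltq] := boolP (lexlt q b); last first.
  have {bltq} bq' : lexlt b q by apply: bltq; rewrite eq_sym.
  have onb : orient p q b != 0.
    by apply/eqP => /(orient_between pb bq') s; apply: (disj b) s; exact: segment_r.
  rewrite bq' /=.
  (* Interleaved heights: exactly one of the two tests must succeed. If both succeed (k = 1) or both
     fail (k = -1), the segments cross. *)
  have [Ap|Ap] := ltP 0 (orient a b p); have [Bb|Bb] := ltP 0 (orient p q b) => //=.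
  - have [||z sz tz] := @interleaved_cross a b p q 1 ap pb bq'; rewrite ?mul1r //.
    by case: (disj z).
  - have [||z sz tz] := @interleaved_cross a b p q (-1) ap pb bq'.
    + by rewrite mulN1r oppr_gt0 lt_neqAle onp.
    + by rewrite mulN1r oppr_gt0 lt_neqAle onb.
    by case: (disj z).
rewrite (lexltF qb) /= addbF.
have onq : orient a b q != 0.
  by apply/eqP => /(orient_between aq qb) s; apply: (disj q) s (segment_r _ _).
(* Nested heights: [p] and [q] must lie on the same side, since otherwise [p q] meets the line [a b]
   at a height between [a] and [b], hence on the segment. *)
have [Ap|Ap] := ltP 0 (orient a b p); have [Bb|Bb] := ltP 0 (orient a b q) => //=.
  all: exfalso; have /orient_cross[t t01 ot] : orient a b p * orient a b q < 0.
  - by rewrite pmulr_rlt0 // lt_neqAle onq.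
  - by apply: (disj _ _); [apply: orient_between ot|exists t];
       rewrite ?lexlt_convex ?lexgt_convex.
  - by rewrite pmulr_llt0 // lt_neqAle onp.
  - by apply: (disj _ _); [apply: orient_between ot|exists t];
       rewrite ?lexlt_convex ?lexgt_convex.
Qed.

Lemma segmentC p q z : segment p q z -> segment q p z.
Proof.
move=> [t t01 ->]; exists (1 - t); first by lra.
by apply: pointP; rewrite !pE; ring.
Qed.

Lemma leftbxx a p : leftb a a p = false.
Proof. by rewrite /leftb orbb; case: (boolP (lexlt a p)) => // /lexltF->. Qed.

Lemma leftb_segments a b p q :
  (forall z, segment a b z -> segment p q z -> False) ->
  leftb a b p (+) leftb a b q (+) leftb p q a (+) leftb p q b =
  lexlt p a (+) lexlt q a (+) lexlt p b (+) lexlt q b.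
Proof.
move=> disj.
have [ab|ab] := eqVneq a b; first by subst b; rewrite !leftbxx; xor.
have [pq|pq] := eqVneq p q; first by subst q; rewrite !leftbxx; xor.
wlog ltab : a b ab disj / lexlt a b => [W|].
  have [/W|/(lexltNge ab) ba] := boolP (lexlt a b); first exact.
  rewrite ![leftb a b _]leftbC; transitivity
    (leftb b a p (+) leftb b a q (+) leftb p q b (+) leftb p q a); first xor.
  rewrite W //; [xor | by rewrite eq_sym |].
  by move=> z /segmentC; apply: disj.
wlog ltpq : p q pq disj / lexlt p q => [W|].
  have [/W|/(lexltNge pq) qp] := boolP (lexlt p q); first exact.
  rewrite ![leftb p q _]leftbC; transitivity
    (leftb a b q (+) leftb a b p (+) leftb q p a (+) leftb q p b); first xor.
  rewrite W //; [xor | by rewrite eq_sym |].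
  by move=> z sz /segmentC; apply: disj.
have ends x y : segment a b x -> segment p q y -> lexlt y x = ~~ lexlt x y.
  move=> sx sy; apply: lexlt_asym; apply/eqP => xy.
  by apply: (disj x) => //; rewrite xy.
have [sa sb] := (segment_l a b, segment_r a b).
have [sp sq] := (segment_l p q, segment_r p q).
have [ap|] := boolP (lexlt a p); first exact: leftb_segments_lt.
rewrite -(ends a p) // => pa.
(* Exchanging the segments negates all four comparisons, which preserves the parity. *)
transitivity (leftb p q a (+) leftb p q b (+) leftb a b p (+) leftb a b q); first xor.
rewrite leftb_segments_lt //; last by move=> z sz tz; apply: disj tz sz.
rewrite (ends a p) // (ends a q) // (ends b p) // (ends b q) //; xor.
Qed.

Fixpoint polyline_left p (s : seq point) k : bool :=
  if s is q :: s' then leftb p q k (+) polyline_left q s' k else false.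

Lemma polyline_left_segment a b p s :
  (forall z, segment a b z -> polyline p s z -> False) ->
  leftb a b p (+) leftb a b (last p s) (+)
    polyline_left p s a (+) polyline_left p s b =
  lexlt p a (+) lexlt (last p s) a (+) lexlt p b (+) lexlt (last p s) b.
Proof.
elim: s p => [|q s IH] p disj /=; first xor.
have := leftb_segments (fun z sz tz => disj z sz (or_introl tz)).
have := IH q (fun z sz tz => disj z sz (or_intror tz)).
move=> H2 H1; have := congr2 addb H1 H2.
set x := (X in X = _ -> _); set y := (X in _ = X -> _) => H.
by transitivity x; [|rewrite H]; rewrite /x /y; xor.
Qed.

Lemma polyline_left_disjoint a s p t :
  (forall z, polyline a s z -> polyline p t z -> False) ->
  polyline_left a s p (+) polyline_left a s (last p t) (+)
    polyline_left p t a (+) polyline_left p t (last a s) =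
  lexlt p a (+) lexlt (last p t) a (+)
    lexlt p (last a s) (+) lexlt (last p t) (last a s).
Proof.
elim: s a => [|b s IH] a disj /=; first xor.
have := polyline_left_segment (fun z sz tz => disj z (or_introl sz) tz).
have := IH b (fun z sz tz => disj z (or_intror sz) tz).
move=> H2 H1; have := congr2 addb H1 H2.
set x := (X in X = _ -> _); set y := (X in _ = X -> _) => H.
by transitivity x; [|rewrite H]; rewrite /x /y; xor.
Qed.

End Lex.

Lemma planar_van_kampen (R : realType) (G : sgraph) :
  planar R G -> van_kampen (@edge G).
Proof.
case=> pos [arc [posI arcP _ arcX]].
(* One polyline is chosen per ordered pair, so those of [(x, y)] and [(y, x)] are unrelated and the
   resulting [h] need not be symmetric. *)
have /choice[s sP] : forall xy : G * G, exists s, edge xy.1 xy.2 ->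
    last (pos xy.1) s = pos xy.2 /\
    arc [set xy.1; xy.2]%SET = polyline (pos xy.1) s.
  move=> [x y] /=; have [exy|_] := boolP (edge x y); last by exists [::].
  by have [s [_ sl sa]] := arcP _ _ exy; exists s.
exists (fun i j k => polyline_left (pos i) (s (i, j)) (pos k)).
exists (fun x y => lexlt (pos x) (pos y)); split.
  by move=> x y xy; apply: lexlt_asym; rewrite (inj_eq posI).
move=> i j k l ij kl U.
have [li ai] := sP (i, j) ij; have [lk ak] := sP (k, l) kl.
have := @polyline_left_disjoint R (pos i) (s (i, j)) (pos k) (s (k, l)).
rewrite /= in li ai lk ak; rewrite li lk; move=> ->.
  xor.
have edgesE x y : edge x y -> [set x; y]%SET \in edges G.
  by move=> xy; rewrite inE; apply/existsP; exists x; apply/existsP; exists y; rewrite xy eqxx.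
(* A common point of the two arcs would be the position of a common endpoint, and independent edges
   have none. *)
have disj : ([set i; j] :&: [set k; l])%SET = finset.set0.
  apply/finset.setP => x; rewrite !inE; apply/negP => /andP[].
  by move=> /orP[] /eqP-> /orP[] /eqP E; move: U; rewrite E /= !inE eqxx ?orbT ?andbF.
move=> z; rewrite -ai -ak => zi zk.
have [|x] := arcX _ _ (edgesE _ _ ij) (edgesE _ _ kl) _ z zi zk.
  by move=> E; move: disj; rewrite E finset.setIid => /finset.setP/(_ k); rewrite !inE eqxx.
by rewrite disj inE.
Qed.

Theorem theorem6p8 (R : realType) (G : sgraph) (planarG : planar R G) :
  (max_degree G <= 5 ->
     list_chromatic_number (square G) <= max_degree G ^ 2 + 1) /\
  (6 <= max_degree G ->
     list_chromatic_number (square G) <= 7 * max_degree G - 7).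
Proof. exact: van_kampen_square (planar_van_kampen planarG). Qed.
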